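(* Let $C_t$ be a $t$-doped Clifford circuit on $n$ qubits written as $C_t=D^\dagger c_tDV$, with $D,V$ Clifford unitaries and $c_t$ a $t$-doped Clifford circuit acting nontrivially only on a subsystem of $t\le n$ qubits. Let the qubits be bipartitioned as $E\cup F$ with $t\le n_F$, let $Y\subset F$ be a set of $n_Y=t$ qubits, let $T_{\pi_Y}$ be a qubit-permutation unitary such that $T_{\pi_Y}c_tT_{\pi_Y}^\dagger$ acts nontrivially only on $Y$, and let $W=T_{\pi_Y}D$. Let $|\psi_t\rangle=C_t|0\rangle^{\otimes n}$, $\psi_t=|\psi_t\rangle\langle\psi_t|$, $\psi_E=\mathrm{tr}_F\psi_t$, and $$\rho:=W^\dagger\big(\mathrm{tr}_Y(W\psi_tW^\dagger)\otimes d_Y^{-1}I_Y\big)W,\qquad \rho_E=\mathrm{tr}_F\rho,\quad\rho_F=\mathrm{tr}_E\rho,$$ with $d_Y=2^{n_Y}$. Then for both $X=E$ and $X=F$, $$\mathrm{Pur}(\psi_E)\le d_Y^2\,\mathrm{Pur}(\rho_X).$$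
   Context: The system consists of $n$ qubits, $\mathcal H=(\mathbb C^2)^{\otimes n}=\mathcal H_E\otimes\mathcal H_F$, where $E,F$ consist of $n_E,n_F$ qubits, $n=n_E+n_F$. A $t$-doped Clifford circuit is a circuit of Clifford gates into which $t$ non-Clifford gates ($T$-gates) have been inserted. The purity of a state $\sigma$ is $\mathrm{Pur}(\sigma)=\mathrm{tr}(\sigma^2)$. In $\rho$, the state $\mathrm{tr}_Y(W\psi_tW^\dagger)$ lives on the complement of $Y$, and $I_Y$ is the identity on $Y$. *)

(* Defs.v *)
From HB Require Import structures.
From mathcomp Require Import all_boot all_order all_algebra all_fingroup.
From mathcomp Require Import spectral complex reals.

Set Implicit Arguments.
Unset Strict Implicit.
Unset Printing Implicit Defensive.

Import Order.TTheory GRing.Theory Num.Theory.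

Local Open Scope ring_scope.
Local Open Scope sesquilinear_scope.

(* A register of qubits is labelled by a finType Q.  Its computational basis
   is indexed by cfg Q, and operators on its Hilbert space (C^2)^{(x) Q} are
   matrices whose rows and columns are numbered through enum_rank/enum_val
   on cfg Q, so that the library's matrix algebra applies.  A subsystem is a
   set S of labels; its own register is labelled by sub_label S. *)
Definition cfg (Q : finType) : finType := {ffun Q -> 'I_2}.
Definition ket (C : numClosedFieldType) (Q : finType) := 'cV[C]_#|cfg Q|.
Definition op (C : numClosedFieldType) (Q : finType) := 'M[C]_#|cfg Q|.
Definition sub_label (Q : finType) (S : {set Q}) : finType := {i : Q | i \in S}.

Section Entries.
Variables (C : numClosedFieldType) (Q : finType).
Implicit Types x y : cfg Q.

Definition opmx (f : cfg Q -> cfg Q -> C) : op C Q :=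
  \matrix_(i, j) f (enum_val i) (enum_val j).

Definition entry (A : op C Q) x y : C := A (enum_rank x) (enum_rank y).

End Entries.

Definition restr (Q : finType) (S : {set Q}) (x : cfg Q) : cfg (sub_label S) :=
  [ffun i => x (val i)].

Definition tensor_op (C : numClosedFieldType) (Q : finType) (S : {set Q})
    (A : op C (sub_label S)) (B : op C (sub_label (~: S))) : op C Q :=
  opmx (fun x y => entry A (restr S x) (restr S y) *
                   entry B (restr (~: S) x) (restr (~: S) y)).

(* <a| tr_S A |b> is the sum of <x|A|y> over the x, y that extend a, b to all
   of Q and agree on S. *)
Definition ptrace (C : numClosedFieldType) (Q : finType) (S : {set Q})
    (A : op C Q) : op C (sub_label (~: S)) :=
  opmx (fun a b =>
    \sum_(x : cfg Q | restr (~: S) x == a)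
      \sum_(y : cfg Q | (restr (~: S) y == b) && (restr S y == restr S x))
        entry A x y).

Section Circuits.
Variables (C : numClosedFieldType) (Q : finType).
Implicit Types (S : {set Q}) (U A : op C Q).

Definition acts_only_on S U : Prop :=
  exists u : op C (sub_label S), U = tensor_op u 1%:M.

Definition ket0 : ket C Q := delta_mx (enum_rank [ffun => ord0]) 0.

Definition proj (psi : ket C Q) : op C Q := psi *m psi ^t*.

(* The value lives in C; for a Hermitian A it is real. *)
Definition Pur A : C := \tr (A *m A).

Definition prod_op (M : Q -> 'M[C]_2) : op C Q :=
  opmx (fun x y => \prod_(i : Q) M i (x i) (y i)).

Definition sigmaX : 'M[C]_2 := \matrix_(a, b) (a != b)%:R.
Definition sigmaZ : 'M[C]_2 := \matrix_(a, b) ((a == b)%:R * (-1) ^+ a).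
Definition sigmaY : 'M[C]_2 := 'i *: (sigmaX *m sigmaZ).
Definition sigma (k : 'I_4) : 'M[C]_2 :=
  nth 0 [:: 1%:M; sigmaX; sigmaY; sigmaZ] k.

Definition pauli_group A : Prop :=
  exists (k : nat) (p : Q -> 'I_4),
    A = 'i ^+ k *: prod_op (fun q => sigma (p q)).

Definition clifford U : Prop :=
  U \is unitarymx /\
  forall P, pauli_group P -> pauli_group (U *m P *m U ^t*).

(* exp(i pi / 4) = (1 + i) / sqrt 2 *)
Definition T_mx : 'M[C]_2 :=
  \matrix_(a, b) ((a == b)%:R * ((1 + 'i) / sqrtC 2) ^+ a).

Definition T_gate (q : Q) : op C Q :=
  prod_op (fun q' => if q' == q then T_mx else 1%:M).

Inductive doped_clifford : nat -> op C Q -> Prop :=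
| doped_base U : clifford U -> doped_clifford 0 U
| doped_step t U K q : doped_clifford t U -> clifford K ->
    doped_clifford t.+1 (K *m T_gate q *m U).

(* The state of qubit q is moved to position s q, that is
   |y> |-> |y \o s^-1>. *)
Definition perm_op (s : {perm Q}) : op C Q :=
  opmx (fun x y => (x == [ffun q => y ((s^-1)%g q)])%:R).

End Circuits.

Arguments ket0 {C Q}.
Arguments perm_op C {Q} s.

(* Main.v *)
Require Import Defs.
From mathcomp Require Import all_boot all_order all_algebra all_fingroup.
From mathcomp Require Import spectral complex reals.

(* In the frame [W] the doping acts as a unitary on [Y], hence it disappears
   when [Y] is traced out: [rho] is the depolarization on [Y] of a stabilizer
   state, and its reductions are multiples of sums over groups of Paulis.  So
   [rho_X ^ 2 = p rho_X] with [p = Pur rho_X], whence [rho_X <= p].  Since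
   [A <= d (1 (x) tr_Y A)] for every positive [A], also [psi <= d^2 rho], and
   [tr (psi_X ^ 2) <= d^2 tr (psi_X rho_X) <= d^2 p tr psi_X = d^2 Pur rho_X].
   Finally [Pur psi_E = Pur psi_F] because [psi] is pure. *)

Set Implicit Arguments.
Unset Strict Implicit.
Unset Printing Implicit Defensive.

Import Order.TTheory GRing.Theory Num.Theory.
Local Open Scope ring_scope.
Local Open Scope sesquilinear_scope.

(** * Algebra of the conjugate transpose *)

Section Adjoint.
Variable C : numClosedFieldType.

Lemma trmxCM m n p (A : 'M[C]_(m, n)) (B : 'M[C]_(n, p)) :
  (A *m B) ^t* = B ^t* *m A ^t*.
Proof. by rewrite trmx_mul map_mxM. Qed.

Lemma trmxCD m n (A B : 'M[C]_(m, n)) : (A + B) ^t* = A ^t* + B ^t*.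
Proof. by apply/matrixP => i j; rewrite !mxE rmorphD. Qed.

Lemma trmxCB m n (A B : 'M[C]_(m, n)) : (A - B) ^t* = A ^t* - B ^t*.
Proof. by apply/matrixP => i j; rewrite !mxE rmorphB. Qed.

Lemma trmxCZ m n c (A : 'M[C]_(m, n)) : (c *: A) ^t* = c^* *: A ^t*.
Proof. by apply/matrixP => i j; rewrite !mxE rmorphM. Qed.

Lemma trmxC_sum (I : Type) (r : seq I) (P : pred I) m n
    (A : I -> 'M[C]_(m, n)) :
  (\sum_(i <- r | P i) A i) ^t* = \sum_(i <- r | P i) (A i) ^t*.
Proof.
apply: (big_morph (fun A : 'M[C]_(m, n) => A ^t*)); first exact: trmxCD.
by apply/matrixP => i j; rewrite !mxE rmorph0.
Qed.

Lemma trmxC_scalar n c : (c%:M : 'M[C]_n) ^t* = (c^*)%:M.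
Proof. by rewrite tr_scalar_mx map_scalar_mx. Qed.

Lemma unitarymx_trmxCK n (U : 'M[C]_n) : U \is unitarymx -> U ^t* *m U = 1%:M.
Proof. by move/unitarymxP/mulmx1C. Qed.

End Adjoint.

(** * Positive semidefinite matrices and trace inequalities *)

Section Psd.
Variable C : numClosedFieldType.

(** Positivity is encoded by a Gram factorization of arbitrary width [m]: sums then come from
    concatenating factors and conjugations from multiplying them, without any spectral theory. *)
Definition psd n (A : 'M[C]_n) : Prop :=
  exists m (B : 'M[C]_(n, m)), A = B *m B ^t*.

Lemma psd_trmxC n (A : 'M[C]_n) : psd A -> A ^t* = A.
Proof. by case=> m [B ->]; rewrite trmxCM trmxCK. Qed.

Lemma psd_conj n m (A : 'M[C]_n) (U : 'M[C]_(m, n)) :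
  psd A -> psd (U *m A *m U ^t*).
Proof. by case=> k [B ->]; exists k, (U *m B); rewrite trmxCM !mulmxA. Qed.

Lemma psdD n (A B : 'M[C]_n) : psd A -> psd B -> psd (A + B).
Proof.
case=> m1 [A1 ->] [m2 [B1 ->]]; exists (m1 + m2)%N, (row_mx A1 B1).
by rewrite tr_row_mx map_col_mx mul_row_col.
Qed.

Lemma psd0 n : psd (0 : 'M[C]_n).
Proof. by exists 0, 0; rewrite mul0mx. Qed.

Lemma psd_sum (I : finType) (P : pred I) n (A : I -> 'M[C]_n) :
  (forall i, P i -> psd (A i)) -> psd (\sum_(i | P i) A i).
Proof.
move=> hA; elim/big_rec: _ => [|i B Pi hB]; first exact: psd0.
exact: psdD (hA i Pi) hB.
Qed.

Lemma psdZ n c (A : 'M[C]_n) : 0 <= c -> psd A -> psd (c *: A).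
Proof.
move=> c0 [m [B ->]]; exists m, (sqrtC c *: B).
rewrite trmxCZ -scalemxAl -scalemxAr scalerA geC0_conj ?sqrtC_ge0 //.
by rewrite -expr2 sqrtCK.
Qed.

Lemma mxtrace_adj_ge0 m n (A : 'M[C]_(m, n)) : 0 <= \tr (A *m A ^t*).
Proof.
apply: sumr_ge0 => i _; rewrite mxE; apply: sumr_ge0 => j _.
by rewrite !mxE mul_conjC_ge0.
Qed.

Lemma psd_trace_ge0 n (A : 'M[C]_n) : psd A -> 0 <= \tr A.
Proof. by case=> m [B ->]; exact: mxtrace_adj_ge0. Qed.

(** Once [A] is factored through [A1], cyclicity turns the trace into that of [B] conjugated by the
    adjoint of [A1], which is again positive. *)
Lemma psd_traceM_ge0 n (A B : 'M[C]_n) : psd A -> psd B -> 0 <= \tr (A *m B).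
Proof.
move=> [m [A1 ->]] /(psd_conj (A1 ^t*)) /psd_trace_ge0.
by rewrite trmxCK mxtrace_mulC mulmxA mxtrace_mulC mulmxA.
Qed.

(* [p (p - A) = (p - A)^2] when [A^2 = p A], so that [A <= p] *)
Lemma flat_traceM_le n (A B : 'M[C]_n) (p : C) :
  psd A -> psd B -> 0 < p -> A *m A = p *: A -> \tr (B *m A) <= p * \tr B.
Proof.
move=> psdA psdB p0 AA; set D := p%:M - A.
have DE : p *: D = D *m D ^t*.
  rewrite /D trmxCB (psd_trmxC psdA) trmxC_scalar geC0_conj ?ltW //.
  rewrite mulmxBl !mulmxBr AA mul_scalar_mx mul_mx_scalar mul_scalar_mx.
  by rewrite scalerBr subrr subr0.
have : 0 <= \tr (B *m (p *: D)).
  by apply: psd_traceM_ge0 => //; rewrite DE; exists n, D.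
rewrite -scalemxAr mxtraceZ pmulr_rge0 // mulmxBr mul_mx_scalar linearB /=.
by rewrite mxtraceZ subr_ge0.
Qed.

End Psd.

(** * Splitting a configuration along a subsystem and its complement *)

Section Configurations.
Variable Q : finType.
Implicit Types (S : {set Q}) (x y : cfg Q).

(** Inverse of the pair of restrictions to [S] and [~: S]. The final [ord0] is never reached, since
    each label lies in one of the two sets. *)
Definition glue S (k : cfg (sub_label S)) (a : cfg (sub_label (~: S))) :
    cfg Q :=
  [ffun q => if insub q is Some i then k i
             else if insub q is Some j then a j else ord0].

Lemma glue_in S k a (i : sub_label S) : glue k a (val i) = k i.
Proof. by rewrite ffunE valK. Qed.

Lemma glue_out S k a (i : sub_label (~: S)) : glue (S := S) k a (val i) = a i.
Proof.
rewrite ffunE insubF ?valK //.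
by apply: negbTE; rewrite -in_setC; exact: (valP i).
Qed.

Lemma restr_glue S k a : restr S (glue k a) = k.
Proof. by apply/ffunP => i; rewrite ffunE glue_in. Qed.

Lemma restrC_glue S k a : restr (~: S) (glue k a) = a.
Proof. by apply/ffunP => i; rewrite ffunE glue_out. Qed.

Lemma glue_restr S x : glue (restr S x) (restr (~: S) x) = x.
Proof.
apply/ffunP => q; rewrite ffunE.
case: insubP => [i _ <-|qS]; first by rewrite ffunE.
case: insubP => [i _ <-|]; first by rewrite ffunE.
by rewrite in_setC qS.
Qed.

Lemma eq_restr S x y :
  (x == y) = (restr S x == restr S y) && (restr (~: S) x == restr (~: S) y).
Proof.
apply/eqP/andP => [->//|[/eqP h1 /eqP h2]].
by rewrite -(glue_restr S x) h1 h2 glue_restr.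
Qed.

Lemma sum_glue S (V : nmodType) (F : cfg Q -> V) :
  \sum_x F x = \sum_k \sum_a F (@glue S k a).
Proof.
rewrite pair_big /=.
rewrite (reindex (fun p => @glue S p.1 p.2)) //=.
exists (fun x => (restr S x, restr (~: S) x)) => [[k a]|x] _ /=.
  by rewrite restr_glue restrC_glue.
exact: glue_restr.
Qed.

Lemma card_cfg : #|cfg Q| = (2 ^ #|Q|)%N.
Proof. by rewrite card_ffun card_ord. Qed.

End Configurations.

Lemma card_cfg_sub (Q : finType) (S : {set Q}) :
  #|cfg (sub_label S)| = (2 ^ #|S|)%N.
Proof. by rewrite card_cfg card_sig. Qed.

Lemma sum_enum_rank (T : finType) (V : nmodType) (F : 'I_#|T| -> V) :
  \sum_i F i = \sum_(x : T) F (enum_rank x).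
Proof.
rewrite (reindex_onto (@enum_rank T) enum_val) => [|i _].
  by apply: eq_bigl => x; rewrite enum_rankK eqxx.
by rewrite enum_valK.
Qed.

(** * Matrix algebra in terms of entries indexed by configurations *)

Section EntryTheory.
Variables (C : numClosedFieldType) (Q : finType).
Implicit Types A B : op C Q.

Lemma entryP A B : (forall x y, entry A x y = entry B x y) -> A = B.
Proof.
move=> h; apply/matrixP => i j.
by have := h (enum_val i) (enum_val j); rewrite /entry !enum_valK.
Qed.

Lemma entry_opmx (f : cfg Q -> cfg Q -> C) x y : entry (opmx f) x y = f x y.
Proof. by rewrite /entry mxE !enum_rankK. Qed.

Lemma entryM A B x y : entry (A *m B) x y = \sum_z entry A x z * entry B z y.
Proof. by rewrite /entry mxE sum_enum_rank. Qed.

Lemma entry1 x y : entry (1%:M : op C Q) x y = (x == y)%:R.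
Proof. by rewrite /entry mxE (inj_eq enum_rank_inj). Qed.

Lemma entryZ c A x y : entry (c *: A) x y = c * entry A x y.
Proof. by rewrite /entry mxE. Qed.

Lemma entry_adj A x y : entry (A ^t*) x y = (entry A y x)^*.
Proof. by rewrite /entry !mxE. Qed.

Lemma entry_sum (I : finType) (F : I -> op C Q) x y :
  entry (\sum_i F i) x y = \sum_i entry (F i) x y.
Proof. by rewrite /entry summxE. Qed.

Lemma mxtrace_entry A : \tr A = \sum_x entry A x x.
Proof. by rewrite /mxtrace sum_enum_rank. Qed.

End EntryTheory.

(** * Tensor products and partial traces through basis inclusions *)

Section Inclusions.
Variables (C : numClosedFieldType) (Q : finType).
Implicit Types (S : {set Q}) (A B : op C Q).

(* [|a> |-> |k> (x) |a>], where [|k>] is a basis state of [S] *)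
Definition incl S (k : cfg (sub_label S)) :
    'M[C]_(#|cfg Q|, #|cfg (sub_label (~: S))|) :=
  \matrix_(i, j) (enum_val i == glue k (enum_val j))%:R.

(** The inclusions are isometries with mutually orthogonal ranges. Together with the resolution of
    the identity [sum_incl], this replaces most entrywise computations below. *)
Lemma inclK S (k l : cfg (sub_label S)) :
  (incl k) ^t* *m incl l = ((k == l)%:R)%:M.
Proof.
apply: entryP => a b; rewrite /entry !mxE sum_enum_rank.
under eq_bigr => x _ do rewrite !mxE !enum_rankK rmorph_nat mulrC.
rewrite (bigD1 (glue l b)) //= eqxx mul1r big1 => [|x /negbTE ->]; last first.
  by rewrite mul0r.
rewrite addr0 (eq_restr S) !restr_glue !restrC_glue (inj_eq enum_rank_inj).
by rewrite [l == _]eq_sym [b == _]eq_sym; case: eqP => _ /=; case: eqP.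
Qed.

Lemma incl_mul_adj_entry S (k l : cfg (sub_label S)) (B : op C _) x y :
  entry (incl k *m B *m (incl l) ^t*) x y =
  (restr S x == k)%:R * (restr S y == l)%:R *
    entry B (restr (~: S) x) (restr (~: S) y).
Proof.
rewrite /entry mxE sum_enum_rank (bigD1 (restr (~: S) y)) //=.
rewrite big1 => [|a]; last first.
  rewrite !mxE !enum_rankK (eq_restr S) restr_glue restrC_glue eq_sym.
  by move=> /negbTE ->; rewrite andbF rmorph0 mulr0.
rewrite addr0 !mxE !enum_rankK (eq_restr S) restr_glue restrC_glue eqxx andbT.
rewrite rmorph_nat sum_enum_rank (bigD1 (restr (~: S) x)) //=.
rewrite big1 => [|a]; last first.
  rewrite !mxE !enum_rankK (eq_restr S) restr_glue restrC_glue eq_sym.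
  by move=> /negbTE ->; rewrite andbF mul0r.
rewrite addr0 !mxE !enum_rankK (eq_restr S) restr_glue restrC_glue eqxx andbT.
by rewrite -!mulrA; congr (_ * _); rewrite mulrC.
Qed.

(** Block expansion: the summand at [k], [l] is [u_kl |k><l| (x) B]. *)
Lemma tensor_opE S (u : op C (sub_label S)) (B : op C (sub_label (~: S))) :
  tensor_op u B =
  \sum_k \sum_l entry u k l *: (incl k *m B *m (incl l) ^t*).
Proof.
apply: entryP => x y; rewrite entry_opmx entry_sum.
rewrite (bigD1 (restr S x)) //= [X in _ + X]big1 => [|k hk]; last first.
  rewrite entry_sum big1 // => l _.
  by rewrite entryZ incl_mul_adj_entry eq_sym (negbTE hk) !mul0r mulr0.
rewrite addr0 entry_sum (bigD1 (restr S y)) //= big1 => [|l hl]; last first.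
  by rewrite entryZ incl_mul_adj_entry [_ == l]eq_sym (negbTE hl)
     mulr0 mul0r mulr0.
by rewrite addr0 entryZ incl_mul_adj_entry !eqxx !mul1r.
Qed.

Lemma tensor_scalar_op S c (B : op C (sub_label (~: S))) :
  tensor_op c%:M B = c *: \sum_k incl k *m B *m (incl k) ^t*.
Proof.
rewrite tensor_opE scaler_sumr; apply: eq_bigr => k _.
rewrite (bigD1 k) //= big1 => [|l /negbTE hl]; last first.
  by rewrite -scalemx1 entryZ entry1 eq_sym hl mulr0 scale0r.
by rewrite -scalemx1 entryZ entry1 eqxx mulr1 addr0.
Qed.

Lemma tensor_op11 S : tensor_op (1%:M : op C (sub_label S)) 1%:M = 1%:M.
Proof.
apply: entryP => x y; rewrite entry_opmx !entry1 (eq_restr S x y).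
by rewrite -natrM mulnb.
Qed.

Lemma sum_incl S : \sum_(k : cfg (sub_label S)) incl k *m (incl k) ^t* = 1%:M.
Proof.
rewrite -(tensor_op11 S) tensor_scalar_op scale1r.
by apply: eq_bigr => k _; rewrite mulmx1.
Qed.

Lemma entry_ptrace S A a b :
  entry (ptrace S A) a b = \sum_k entry A (@glue Q S k a) (glue k b).
Proof.
rewrite entry_opmx big_mkcond (sum_glue S) /=.
apply: eq_bigr => k _; rewrite (bigD1 a) //=.
rewrite [X in _ + X]big1 => [|c hc]; last by rewrite restrC_glue (negbTE hc).
rewrite addr0 restrC_glue eqxx.
rewrite (bigD1 (glue k b)) /=; last by rewrite restrC_glue !restr_glue !eqxx.
rewrite big1 => [|y /andP[/andP[/eqP hb /eqP hk]]]; first by rewrite addr0.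
by rewrite restr_glue in hk; rewrite -hb -hk glue_restr eqxx.
Qed.

(** This Kraus form of the partial trace makes linearity and positivity immediate. *)
Lemma ptraceE S A : ptrace S A = \sum_k (incl k) ^t* *m A *m incl k.
Proof.
apply: entryP => a b; rewrite entry_ptrace entry_sum.
apply: eq_bigr => k _; rewrite /entry [RHS]mxE sum_enum_rank.
rewrite (bigD1 (glue k b)) //= [X in _ + X]big1 => [|x hx]; last first.
  by rewrite [in X in _ * X]mxE !enum_rankK (negbTE hx) mulr0.
rewrite addr0 mxE sum_enum_rank (bigD1 (glue k a)) //=.
rewrite [X in _ + X]big1 => [|x hx]; last first.
  by rewrite !mxE !enum_rankK (negbTE hx) rmorph0 mul0r.
by rewrite !mxE !enum_rankK !eqxx rmorph1 addr0 mul1r mulr1.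
Qed.

End Inclusions.

(** * Partial trace: positivity, local unitaries and domination *)

Section PartialTrace.
Variables (C : numClosedFieldType) (Q : finType) (S : {set Q}).
Implicit Types (A B : op C Q).

Lemma mxtrace_ptrace A : \tr (ptrace S A) = \tr A.
Proof.
rewrite ptraceE raddf_sum /= -[in RHS](mul1mx A) -(sum_incl C S) mulmx_suml.
rewrite raddf_sum; apply: eq_bigr => k _ /=.
by rewrite mxtrace_mulC mulmxA.
Qed.

Lemma ptraceB A B : ptrace S (A - B) = ptrace S A - ptrace S B.
Proof.
rewrite !ptraceE -sumrB; apply: eq_bigr => k _.
by rewrite mulmxBr mulmxBl.
Qed.

Lemma ptraceZ c A : ptrace S (c *: A) = c *: ptrace S A.
Proof.
rewrite !ptraceE scaler_sumr; apply: eq_bigr => k _.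
by rewrite -scalemxAr -scalemxAl.
Qed.

Lemma ptrace_sum (I : finType) (P : pred I) (F : I -> op C Q) :
  ptrace S (\sum_(i | P i) F i) = \sum_(i | P i) ptrace S (F i).
Proof.
rewrite ptraceE; under eq_bigr => k _ do rewrite mulmx_sumr mulmx_suml.
by rewrite exchange_big; apply: eq_bigr => i _; rewrite ptraceE.
Qed.

Lemma psd_ptrace A : psd A -> psd (ptrace S A).
Proof.
move=> psdA; rewrite ptraceE; apply: psd_sum => k _.
by have := psd_conj ((incl C k) ^t*) psdA; rewrite trmxCK.
Qed.

Lemma tensor_op_sumr (I : finType) (P : pred I) u
    (F : I -> op C (sub_label (~: S))) :
  tensor_op u (\sum_(i | P i) F i) = \sum_(i | P i) tensor_op u (F i).
Proof.
apply: entryP => x y; rewrite entry_opmx [RHS]summxE /entry summxE mulr_sumr.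
by apply: eq_bigr => i _; rewrite mxE !enum_rankK.
Qed.

Lemma tensor_opZr c (u : op C (sub_label S)) (B : op C (sub_label (~: S))) :
  tensor_op u (c *: B) = c *: tensor_op u B.
Proof.
by apply: entryP => x y; rewrite entryZ !entry_opmx entryZ mulrCA.
Qed.

Lemma tensor_scalarE c (B : op C (sub_label (~: S))) :
  tensor_op c%:M B = c *: tensor_op 1%:M B.
Proof. by rewrite !tensor_scalar_op scale1r. Qed.

Lemma tensor_op1M (A B : op C (sub_label (~: S))) :
  tensor_op (1%:M : op C (sub_label S)) A *m tensor_op 1%:M B =
  tensor_op 1%:M (A *m B).
Proof.
rewrite !tensor_scalar_op !scale1r mulmx_suml; apply: eq_bigr => k _.
rewrite mulmx_sumr (bigD1 k) //=.
rewrite [X in _ + X]big1 => [|l /negbTE hl]; last first.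
  by rewrite !mulmxA -(mulmxA (incl C k *m A)) inclK eq_sym hl mul_mx_scalar
     scale0r !mul0mx.
by rewrite addr0 !mulmxA -(mulmxA (incl C k *m A)) inclK eqxx mulmx1.
Qed.

Lemma ptrace_tensor_op (u : op C (sub_label S)) (B : op C (sub_label (~: S))) :
  ptrace S (tensor_op u B) = \tr u *: B.
Proof.
apply: entryP => a b; rewrite entry_ptrace entryZ mxtrace_entry mulr_suml.
by apply: eq_bigr => k _; rewrite entry_opmx !restr_glue !restrC_glue.
Qed.

Lemma ptrace_tensor_op1 (B : op C (sub_label (~: S))) :
  ptrace S (tensor_op 1%:M B) = (2 ^ #|S|)%:R *: B.
Proof. by rewrite ptrace_tensor_op mxtrace1 (card_cfg_sub S). Qed.

(** Multiplying by [U] only recombines the blocks [<k|] with coefficients [u_kl], and summing over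
    [k] collapses the coefficients because the columns of [u] are orthonormal. *)
Lemma ptrace_local_unitary U A : acts_only_on S U -> U \is unitarymx ->
  ptrace S (U *m A *m U ^t*) = ptrace S A.
Proof.
case=> u UE Uu.
have JU k : (incl C k) ^t* *m U = \sum_l entry u k l *: (incl C l) ^t*.
  rewrite UE tensor_opE mulmx_sumr (bigD1 k) //=.
  rewrite [X in _ + X]big1 => [|k' hk]; last first.
    rewrite mulmx_sumr big1 // => l _.
    by rewrite mulmx1 -scalemxAr mulmxA inclK eq_sym (negbTE hk) mul_scalar_mx
       scale0r scaler0.
  rewrite addr0 mulmx_sumr; apply: eq_bigr => l _.
  by rewrite mulmx1 -scalemxAr mulmxA inclK eqxx mul1mx.
have UJ k : U ^t* *m incl C k = \sum_l (entry u k l)^* *: incl C l.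
  rewrite -[LHS]trmxCK trmxCM trmxCK JU trmxC_sum; apply: eq_bigr => l _.
  by rewrite trmxCZ trmxCK.
(* The hypothesis gives unitarity of [U], not of its local factor [u]. The latter is recovered by
   sandwiching [U^* U = 1] between two inclusions, with the resolution of the identity inserted in
   the middle. *)
have uu l l' : \sum_k entry u k l * (entry u k l')^* = (l == l')%:R.
  have : \sum_(k : cfg (sub_label S))
      (incl C l') ^t* *m U ^t* *m (incl C k *m (incl C k) ^t*) *m U *m incl C l
      = (l' == l)%:R%:M.
    rewrite -mulmx_suml -mulmx_suml -mulmx_sumr sum_incl mulmx1.
    by rewrite -(mulmxA _ (U ^t*)) unitarymx_trmxCK // mulmx1 inclK.
  have JUJ k : (incl C k) ^t* *m U *m incl C l = (entry u k l)%:M.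
    rewrite JU mulmx_suml (bigD1 l) //= [X in _ + X]big1 => [|j /negbTE hj].
      by rewrite addr0 -scalemxAl inclK eqxx scalemx1.
    by rewrite -scalemxAl inclK hj scale_scalar_mx mulr0 -scalemx1 scale0r.
  have JUJ' k : (incl C l') ^t* *m U ^t* *m incl C k = ((entry u k l')^*)%:M.
    rewrite -mulmxA UJ mulmx_sumr (bigD1 l') //= [X in _ + X]big1 => [|j hj].
      by rewrite addr0 -scalemxAr inclK eqxx scalemx1.
    by rewrite -scalemxAr inclK eq_sym (negbTE hj) scale_scalar_mx mulr0
       -scalemx1 scale0r.
  under eq_bigr => k _.
    rewrite mulmxA -[X in X *m incl C l]mulmxA -mulmxA JUJ JUJ'.
    rewrite mul_scalar_mx scale_scalar_mx mulrC.
    over.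
  (* Both sides are scalar matrices; the scalar is read off at the all-zero configuration, which
     exists even when [~: S] is empty. *)
  move=> /(congr1 (fun M : op C (sub_label (~: S)) =>
                     entry M [ffun=> ord0] [ffun=> ord0])).
  rewrite entry_sum -scalemx1 entryZ entry1 eqxx mulr1 eq_sym => <-.
  by apply: eq_bigr => k _; rewrite -scalemx1 entryZ entry1 eqxx mulr1.
rewrite !ptraceE.
under eq_bigr => k _.
  rewrite !mulmxA -(mulmxA _ (U ^t*)) JU UJ !mulmx_suml.
  under eq_bigr => l _ do rewrite mulmx_sumr.
  over.
rewrite exchange_big /=; apply: eq_bigr => l _.
rewrite exchange_big /= (bigD1 l) //= [X in _ + X]big1 => [|l' hl].
  have ull : \sum_k entry u k l * (entry u k l)^* = 1 by rewrite uu eqxx.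
  rewrite addr0 -[RHS]scale1r -ull scaler_suml.
  apply: eq_bigr => k _.
  by rewrite -!scalemxAl -scalemxAr scalerA mulrC.
under eq_bigr => k _ do rewrite -!scalemxAl -scalemxAr scalerA.
by rewrite -scaler_suml uu eq_sym (negbTE hl) scale0r.
Qed.

(* Split the identity of [S] into the basis projections [P k]: the off-diagonal
   part of the trace is manifestly positive, and the diagonal part dominates
   [A] because
   [\sum_(k, l) (P k - P l) A (P k - P l)^* = 2 (d \sum_k P k A P k - A)]. *)
Lemma psd_tensor_ptrace_sub A : psd A ->
  psd ((2 ^ #|S|)%:R *: tensor_op 1%:M (ptrace S A) - A).
Proof.
move=> psdA; set d : C := _%:R.
pose P k := incl C k *m (incl C (S := S) k) ^t*.
have Padj k : (P k) ^t* = P k by rewrite trmxCM trmxCK.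
pose D k l := (P k - P l) *m A *m (P k - P l) ^t*.
(* [O k l] is [|k><k| (x) <l|A|l>]: these terms sum to [1 (x) tr_S A], and [O k k] is
   [P k A P k]. *)
pose O k l := (incl C k *m (incl C l) ^t*) *m A *m
              (incl C k *m (incl C (S := S) l) ^t*) ^t*.
have sumD : \sum_k \sum_l D k l = 2 *: (d *: (\sum_k P k *m A *m P k) - A).
  have DE k l : D k l = P k *m A *m P k - P k *m A *m P l -
                         (P l *m A *m P k - P l *m A *m P l).
    by rewrite /D trmxCB !Padj !mulmxBl !mulmxBr.
  have dE (F : op C Q) : \sum_(k : cfg (sub_label S)) F = d *: F.
    by rewrite sumr_const card_cfg_sub scaler_nat.
  under eq_bigr => k _.
    under eq_bigr => l _ do rewrite DE.
    rewrite !sumrB dE -mulmx_sumr sum_incl mulmx1 -!mulmx_suml sum_incl mul1mx.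
    over.
  rewrite !sumrB -!mulmx_suml -mulmx_sumr sum_incl mul1mx mulmx1 dE.
  by rewrite -scaler_sumr -[A - _]opprB opprK scaler_nat mulr2n.
have -> : d *: tensor_op 1%:M (ptrace S A) - A =
    2^-1 *: (\sum_k \sum_l D k l) + d *: (\sum_k \sum_(l | l != k) O k l).
  rewrite sumD scalerA mulVf ?pnatr_eq0 // scale1r addrAC -scalerDr -big_split.
  congr (_ *: _ - _); rewrite tensor_scalar_op scale1r ptraceE.
  apply: eq_bigr => k _; rewrite mulmx_sumr mulmx_suml (bigD1 k) //=.
  by congr (_ + _); rewrite /P ?mulmxA //; apply: eq_bigr => l _;
     rewrite /O trmxCM trmxCK !mulmxA.
apply: psdD; apply: psdZ; rewrite /d ?invr_ge0 ?ler0n //.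
  by do 2![apply: psd_sum => ? _]; exact: (psd_conj (P _ - P _) psdA).
by do 2![apply: psd_sum => ? _]; exact: psd_conj.
Qed.

End PartialTrace.

(** * Equal purities of complementary reductions of a pure state *)

Section MixedPurity.
Variables (C : numClosedFieldType) (Q : finType).
Implicit Types (S : {set Q}) (A : op C Q) (x y : cfg Q).

Definition mix S x y : cfg Q := [ffun q => if q \in S then x q else y q].

Lemma mixC S x y : mix (~: S) x y = mix S y x.
Proof. by apply/ffunP => q; rewrite !ffunE in_setC if_neg. Qed.

Lemma mix_glue S k a l b :
  mix S (@glue Q S k a) (@glue Q S l b) = glue k b.
Proof.
apply/ffunP => q; rewrite !ffunE; case: ifP => qS.
  by case: insubP => //=; rewrite qS.
by case: insubP => //= i; rewrite qS.
Qed.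

(** The swap trick: the purity of a reduction is computed on two copies of [A] with the parts
    outside [S] exchanged. *)
Lemma Pur_ptraceE S A :
  Pur (ptrace S A) =
  \sum_x \sum_y entry A x (mix S x y) * entry A y (mix S y x).
Proof.
rewrite /Pur mxtrace_entry (sum_glue S) exchange_big /=.
apply: eq_bigr => a _; rewrite entryM.
under [LHS]eq_bigr => b _ do rewrite !entry_ptrace mulr_suml.
rewrite exchange_big; apply: eq_bigr => k _ /=.
rewrite (sum_glue S) exchange_big; apply: eq_bigr => b _ /=.
by rewrite mulr_sumr; apply: eq_bigr => l _; rewrite !mix_glue.
Qed.

(** Replacing [S] by its complement exchanges [mix S x y] and [mix S y x]. For [v v^*] each summand
    is a product of four amplitudes in which these two occur symmetrically, so no Schmidt
    decomposition is required. *)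
Lemma Pur_ptrace_setC S (v : ket C Q) :
  Pur (ptrace (~: S) (proj v)) = Pur (ptrace S (proj v)).
Proof.
rewrite !Pur_ptraceE; apply: eq_bigr => x _; apply: eq_bigr => y _.
rewrite !mixC /entry !mxE !big_ord1 !mxE.
by rewrite mulrACA [(_)^* * _]mulrC mulrACA.
Qed.

End MixedPurity.

(** * Products of one-qubit operators *)

Section ProductOperators.
Variables (C : numClosedFieldType) (Q : finType).
Implicit Types (S : {set Q}) (M N : Q -> 'M[C]_2).

Lemma eq_prod_op M N : M =1 N -> prod_op M = prod_op N.
Proof.
move=> MN; apply: entryP => x y; rewrite !entry_opmx.
by apply: eq_bigr => q _; rewrite MN.
Qed.

Lemma prod_opM M N : prod_op M *m prod_op N = prod_op (fun q => M q *m N q).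
Proof.
apply: entryP => x y; rewrite entryM entry_opmx.
under [RHS]eq_bigr => q _ do rewrite mxE.
rewrite bigA_distr_bigA; apply: eq_bigr => z _.
by rewrite !entry_opmx -big_split.
Qed.

Lemma prodr_forall (P : pred Q) :
  \prod_q (P q)%:R = [forall q, P q]%:R :> C.
Proof.
case: (boolP [forall q, P q]) => [/forallP hP|/forallPn[q /negbTE hq]].
  by rewrite big1 // => q _; rewrite hP.
by rewrite (bigD1 q) //= hq mul0r.
Qed.

Lemma eq_cfgE (x y : cfg Q) : [forall q, x q == y q] = (x == y).
Proof. by apply/eqfunP/eqP => [h|->//]; apply/ffunP => q; exact: h. Qed.

Lemma prod_op1 : prod_op (fun _ : Q => 1%:M : 'M[C]_2) = 1%:M.
Proof.
apply: entryP => x y; rewrite entry_opmx entry1 -eq_cfgE -prodr_forall.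
by apply: eq_bigr => q _; rewrite mxE.
Qed.

Lemma prod_op_trmxC M : (prod_op M) ^t* = prod_op (fun q => (M q) ^t*).
Proof.
apply: entryP => x y; rewrite entry_adj !entry_opmx rmorph_prod.
by apply: eq_bigr => q _; rewrite !mxE.
Qed.

Lemma prod_op_unitary M :
  (forall q, M q \is unitarymx) -> prod_op M \is unitarymx.
Proof.
move=> Mu; apply/unitarymxP; rewrite prod_op_trmxC prod_opM -prod_op1.
by apply: eq_prod_op => q; apply/unitarymxP.
Qed.

Lemma mxtrace_prod_op M : \tr (prod_op M) = \prod_q \tr (M q).
Proof.
rewrite mxtrace_entry [RHS]bigA_distr_bigA.
by apply: eq_bigr => x _; rewrite entry_opmx.
Qed.

End ProductOperators.

Lemma prod_op_tensor (C : numClosedFieldType) (Q : finType) (S : {set Q})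
    (M : Q -> 'M[C]_2) :
  prod_op M = tensor_op (prod_op (fun i : sub_label S => M (val i)))
                        (prod_op (fun i : sub_label (~: S) => M (val i))).
Proof.
apply: entryP => x y; rewrite !entry_opmx (bigID (mem S)) /=.
rewrite big_sub; congr (_ * _); first by apply: eq_bigr => i _; rewrite !ffunE.
rewrite (eq_bigl (fun q => q \in ~: S)) => [|q]; last by rewrite in_setC.
by rewrite big_sub; apply: eq_bigr => i _; rewrite !ffunE.
Qed.

(** * Pauli, Clifford, permutation and doped Clifford operators *)

Section Pauli.
Variables (C : numClosedFieldType).

Lemma mxtrace_sigma (k : 'I_4) : k != ord0 -> \tr (sigma C k) = 0.
Proof.
rewrite /mxtrace !big_ord_recl big_ord0 addr0.
case: k => [[|[|[|[|//]]]] hk] //= _; rewrite /sigma /=.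
- by rewrite !mxE /= addr0.
- rewrite !mxE !big_ord_recl !big_ord0 !mxE /=.
  by rewrite !(mul0r, mulr0, addr0).
- by rewrite !mxE /= expr1 !mul1r subrr.
Qed.

Lemma imaginaryC_exp4 : 'i ^+ 4 = 1 :> C.
Proof. by rewrite (exprM _ 2 2) sqrCi -signr_odd. Qed.

Lemma pauli_group_tensor1 (Q : finType) (S : {set Q})
    (P : op C (sub_label (~: S))) :
  pauli_group P -> pauli_group (tensor_op (1%:M : op C (sub_label S)) P).
Proof.
(* The default [ord0] indexes the identity, so the padded string is trivial on [S]. *)
case=> k [p ->]; exists k, (fun q => oapp p ord0 (insub q)).
rewrite tensor_opZr (prod_op_tensor S); congr (_ *: tensor_op _ _).
  rewrite -prod_op1; apply: eq_prod_op => i /=; rewrite insubF //.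
  by apply: negbTE; rewrite in_setC negbK (valP i).
by apply: eq_prod_op => i /=; rewrite valK.
Qed.

(** Either all factors of the string inside [S] are the identity, or one of them is a traceless
    Pauli matrix and annihilates the partial trace. *)
Lemma pauli_group_ptrace (Q : finType) (S : {set Q}) (P : op C Q) :
  pauli_group P ->
  (exists2 P' : op C (sub_label (~: S)),
     pauli_group P' & P = tensor_op 1%:M P') \/ ptrace S P = 0.
Proof.
case=> k [p ->]; rewrite (prod_op_tensor S) -tensor_opZr.
case: (boolP [forall i : sub_label S, p (val i) == ord0]) => [/eqfunP h|].
  left; exists ('i ^+ k *: prod_op (fun i => sigma C (p (val i)))).
    by exists k, (fun i => p (val i)).
  congr tensor_op; rewrite -prod_op1; apply: eq_prod_op => i.
  by rewrite h.
case/forallPn => i hi; right; rewrite ptrace_tensor_op mxtrace_prod_op.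
by rewrite (bigD1 i) //= mxtrace_sigma // mul0r scale0r.
Qed.

Variable Q : finType.
Implicit Types (U : op C Q).

(** The exponent of the phase may be reduced modulo 4, which turns the Pauli group into a finite
    list fit for counting. *)
Definition pauli_seq : seq (op C Q) :=
  [seq 'i ^+ val kp.1 *: prod_op (fun q => sigma C (kp.2 q))
     | kp : 'I_4 * {ffun Q -> 'I_4}].

Lemma mem_pauli_seq (P : op C Q) : P \in pauli_seq <-> pauli_group P.
Proof.
split=> [/codomP[[k p] ->]|[k [p ->]]].
  by exists (val k), p.
apply/codomP; exists (inord (k %% 4), finfun p) => /=.
rewrite inordK ?ltn_pmod // expr_mod ?imaginaryC_exp4 //.
by congr (_ *: _); apply: eq_prod_op => q; rewrite ffunE.
Qed.

(* The Pauli group is finite, so the injection [P |-> U P U^*] permutes it. *)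
Lemma clifford_trmxC U : clifford U -> clifford (U ^t*).
Proof.
case=> Uu UP; split=> [|P hP]; first by rewrite trmxC_unitary.
pose h P := U *m P *m U ^t*.
have hK P' : U ^t* *m h P' *m U = P'.
  by rewrite /h !mulmxA unitarymx_trmxCK // mul1mx -mulmxA
     unitarymx_trmxCK // mulmx1.
pose L := undup pauli_seq.
have hL P' : P' \in L <-> pauli_group P'.
  by rewrite mem_undup; exact: mem_pauli_seq.
(* The image of [L] is duplicate-free, contained in [L] and of the same size, so every Pauli has a
   preimage under [h]. *)
have [|||_ eqL] := @uniq_min_size _ (map h L) L; rewrite ?size_map //.
- by rewrite map_inj_uniq ?undup_uniq //;
  exact: (can_inj (g := fun A => U ^t* *m A *m U)).
- by move=> _ /mapP[P' /hL P'P ->]; apply/hL; exact: UP.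
have : P \in map h L by rewrite eqL; apply/hL.
by case/mapP => P' /hL P'P ->; rewrite trmxCK hK.
Qed.

Lemma clifford_mul U V : clifford U -> clifford V -> clifford (U *m V).
Proof.
move=> [Uu UP] [Vu VP]; split=> [|P hP]; first exact: mul_unitarymx.
by have := UP _ (VP _ hP); rewrite trmxCM !mulmxA.
Qed.

Lemma perm_op_conj (s : {perm Q}) (A : op C Q) x y :
  entry (perm_op C s *m A *m (perm_op C s) ^t*) x y =
  entry A [ffun q => x (s q)] [ffun q => y (s q)].
Proof.
have eqs (x' y' : cfg Q) : (x' == [ffun q => y' ((s^-1)%g q)]) =
    (y' == [ffun q => x' (s q)]).
  apply/eqP/eqP => ->; apply/ffunP => q; rewrite !ffunE.
    by rewrite permK.
  by rewrite permKV.
rewrite entryM (bigD1 [ffun q => y (s q)]) //= big1 => [|z /negbTE hz].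
  rewrite entry_adj entry_opmx eqs eqxx rmorph1 mulr1 addr0.
  rewrite entryM (bigD1 [ffun q => x (s q)]) //= big1 => [|z /negbTE hz].
    by rewrite entry_opmx eqs eqxx mul1r addr0.
  by rewrite entry_opmx eqs hz mul0r.
by rewrite entry_adj entry_opmx eqs hz rmorph0 mulr0.
Qed.

Lemma perm_op_prod_op (s : {perm Q}) (M : Q -> 'M[C]_2) :
  perm_op C s *m prod_op M *m (perm_op C s) ^t* =
  prod_op (fun q => M ((s^-1)%g q)).
Proof.
apply: entryP => x y; rewrite perm_op_conj !entry_opmx.
rewrite [RHS](reindex_inj (@perm_inj _ s)) /=.
by apply: eq_bigr => q _; rewrite !ffunE permK.
Qed.

Lemma clifford_perm_op (s : {perm Q}) : clifford (perm_op C s).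
Proof.
split=> [|_ [k [p ->]]].
  (* Unitarity is the conjugation formula applied to the product of identities. *)
  apply/unitarymxP; have := perm_op_prod_op s (fun=> 1%:M).
  by rewrite !prod_op1 mulmx1.
exists k, (fun q => p ((s^-1)%g q)).
by rewrite -scalemxAr -scalemxAl perm_op_prod_op.
Qed.

Lemma T_mx_unitary : T_mx C \is unitarymx.
Proof.
apply/unitarymxP/matrixP => a b; rewrite !mxE (bigD1 a) //= big1 => [|d hd].
  rewrite !mxE eqxx mul1r addr0 rmorphM rmorph_nat rmorphXn /= eq_sym.
  case: eqP => [->|_]; last by rewrite mul0r mulr0.
  (* The diagonal entry is a power of [(1 + i)(1 - i) / 2 = 1]. *)
  rewrite mul1r -exprMn rmorphM rmorphD rmorph1 /= conjCi fmorphV /=.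
  rewrite geC0_conj ?sqrtC_ge0 ?ler0n // mulrACA [(1 + 'i) * _]mulrC
    -subr_sqr expr1n sqrCi.
  by rewrite -invfM -expr2 sqrtCK opprK -mulr2n mulfV ?expr1n ?pnatr_eq0.
by rewrite !mxE eq_sym (negbTE hd) !mul0r.
Qed.

Lemma doped_clifford_unitary t U : doped_clifford t U -> U \is unitarymx.
Proof.
elim=> [{}U [] //|{}t {}U K q _ Uu [Ku _]].
apply: mul_unitarymx => //; apply: mul_unitarymx => //.
apply: prod_op_unitary => q'; case: eqP => _; first exact: T_mx_unitary.
by apply/unitarymxP; rewrite trmxC_scalar conjC1 mulmx1.
Qed.

End Pauli.

(** * Stabilizer operators and their closure properties *)

Section StabilizerOperators.
Variable C : numClosedFieldType.

(* Normalized sums of a group of Paulis: the unnormalized (possibly mixed)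
   stabilizer states. *)
Definition stabilizer_op (Q : finType) (A : op C Q) : Prop :=
  exists (gT : finGroupType) (G : {group gT}) (f : gT -> op C Q) (c : C),
    [/\ 0 < c /\ f 1%g = 1%:M,
        {in G &, forall g h, f (g * h)%g = f g *m f h},
        {in G, forall g, pauli_group (f g)}
      & A = c *: \sum_(g in G) f g].

(** Multiplication by any [f g] permutes the terms of the group sum, so squaring the sum multiplies
    it by the order of [G]. *)
Lemma stabilizer_op_flat (Q : finType) (A : op C Q) :
  stabilizer_op A -> exists2 p, 0 < p & A *m A = p *: A.
Proof.
case=> gT [G [f [c [[c0 _] fM _ ->]]]].
exists (c * #|G|%:R); first by rewrite mulr_gt0 // ltr0n cardG_gt0.
rewrite -scalemxAl -scalemxAr -scalerA; congr (_ *: _).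
rewrite scalerA [_ * c]mulrC -scalerA; congr (_ *: _).
rewrite mulmx_suml scaler_nat -sumr_const; apply: eq_bigr => g gG.
rewrite mulmx_sumr [RHS](reindex_inj (mulgI g)) /=.
by apply: eq_big => h; [rewrite groupMl | move=> hG; rewrite fM].
Qed.

Lemma stabilizer_op_conj (Q : finType) (U A : op C Q) :
  clifford U -> stabilizer_op A -> stabilizer_op (U *m A *m U ^t*).
Proof.
move=> [Uu UP] [gT [G [f [c [[c0 f1] fM fP ->]]]]].
exists gT, G, (fun g => U *m f g *m U ^t*), c; split.
- by rewrite f1 mulmx1 (unitarymxP Uu).
- move=> g h gG hG; rewrite fM // !mulmxA; congr (_ *m _ *m _).
  by rewrite -[RHS]mulmxA unitarymx_trmxCK ?mulmx1.
- by move=> g gG; apply: UP; apply: fP.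
- by rewrite -scalemxAr -scalemxAl mulmx_sumr mulmx_suml.
Qed.

Lemma stabilizer_op_tensor (Q : finType) (S : {set Q}) (d : C)
    (B : op C (sub_label (~: S))) :
  0 < d -> stabilizer_op B -> stabilizer_op (tensor_op d%:M B).
Proof.
move=> d0 [gT [G [f [c [[c0 f1] fM fP ->]]]]].
exists gT, G, (fun g => tensor_op 1%:M (f g)), (d * c); split.
- by rewrite mulr_gt0 // f1 tensor_op11.
- by move=> g h gG hG; rewrite fM // tensor_op1M.
- by move=> g gG; apply: pauli_group_tensor1; apply: fP.
- by rewrite tensor_scalarE tensor_opZr tensor_op_sumr scalerA.
Qed.

(* The Paulis supported off [S] form a subgroup; the others are killed by the
   trace over [S]. *)
Lemma stabilizer_op_ptrace (Q : finType) (S : {set Q}) (A : op C Q) :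
  stabilizer_op A -> stabilizer_op (ptrace S A).
Proof.
move=> [gT [G [f [c [[c0 f1] fM fP ->]]]]].
set d : C := (2 ^ #|S|)%:R.
have d0 : 0 < d by rewrite ltr0n expn_gt0.
(* The trace of the identity on [S] is [d]; dividing by it makes [f' g] the factor off [S] whenever
   [f g] is trivial on [S]. *)
pose f' g := d^-1 *: ptrace S (f g).
have f'E g B : f g = tensor_op 1%:M B -> f' g = B.
  move=> fg; rewrite /f' fg ptrace_tensor_op1 scalerA mulVf ?gt_eqF //.
  by rewrite scale1r.
pose G' := [set g in G | f g == tensor_op 1%:M (f' g)].
have f'1 : f' 1%g = 1%:M by apply: f'E; rewrite f1 tensor_op11.
have f'M : {in G' &, forall g h, f' (g * h)%g = f' g *m f' h}.
  move=> g h; rewrite !inE => /andP[gG /eqP fg] /andP[hG /eqP fh].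
  by apply: f'E; rewrite fM // fg fh tensor_op1M.
have grpG' : group_set G'.
  apply/group_setP; split=> [|g h gG' hG'].
    by rewrite inE group1 f'1 f1 tensor_op11 eqxx.
  rewrite inE f'M //; move: gG' hG'; rewrite !inE.
  move=> /andP[gG /eqP fg] /andP[hG /eqP fh].
  by rewrite groupM // fM // fg fh tensor_op1M eqxx.
have fP' g : g \in G ->
    if g \in G' then pauli_group (f' g) else ptrace S (f g) = 0.
  move=> gG; rewrite inE gG /=.
  case: (pauli_group_ptrace S (fP g gG)) => [[P PP fg]|fg].
    by rewrite (f'E g P) // fg eqxx.
  (* If the trace vanished and [f g] still equalled [1 (x) f' g], then [f g] would be zero, although
     [f (g^-1)] inverts it. *)
  case: eqP => // fg0.
  have := fM _ _ gG (groupVr gG).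
  rewrite mulgV f1 fg0 /f' fg scaler0 -(scale0r (1%:M : op C _)) tensor_opZr.
  rewrite scale0r mul0mx.
  move=> /(congr1 (fun M : op C Q => entry M [ffun=> ord0] [ffun=> ord0])).
  rewrite entry1 eqxx /entry mxE => /eqP.
  by rewrite oner_eq0.
exists gT, (Group grpG'), f', (c * d); split=> //=.
- by rewrite mulr_gt0.
- move=> g gG'; have gG : g \in G by move: gG'; rewrite inE => /andP[].
  by have := fP' g gG; rewrite gG'.
- rewrite ptraceZ ptrace_sum -scalerA; congr (_ *: _).
  rewrite (bigID (mem G')) /= [X in _ + X]big1 => [|g /andP[gG gG']].
    rewrite addr0 scaler_sumr; apply: eq_big => [g|g _].
      by rewrite inE; case: (g \in G).
    by rewrite /f' scalerA mulfV ?gt_eqF // scale1r.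
  by have := fP' g gG; rewrite (negbTE gG').
Qed.

(** On each qubit [|0><0| = (1 + Z) / 2], so the projector is the average of all strings of [1] and
    [Z]. They are indexed by row vectors over ['Z_2], whose additive group serves as [G]; [inord 3]
    is the index of [sigmaZ]. *)
Lemma stabilizer_op_ket0 (Q : finType) : stabilizer_op (proj (ket0 : ket C Q)).
Proof.
pose Z (z : 'Z_2) := sigma C (if z == 0 then ord0 else inord 3).
have ZM z w : Z (z + w) = Z z *m Z w.
  have ZE : sigma C (inord 3) = sigmaZ C by rewrite /sigma inordK.
  have ZZ : sigmaZ C *m sigmaZ C = 1%:M.
    apply/matrixP => a b; rewrite !mxE (bigD1 a) //= big1 => [|e /negbTE he].
      rewrite !mxE eqxx mul1r addr0; case: eqP => [->|_].
        by rewrite mul1r -exprMn mulrNN mulr1 expr1n.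
      by rewrite mul0r mulr0.
    by rewrite !mxE eq_sym he !mul0r.
  rewrite /Z; case: z => [[|[|//]]] hz; case: w => [[|[|//]]] hw;
    by rewrite ?ZE /sigma /= ?mul1mx ?mulmx1 ?ZZ.
pose f (z : 'rV['Z_2]_#|Q|) := prod_op (fun q => Z (z 0 (enum_rank q))).
exists 'rV['Z_2]_#|Q|, [set: 'rV['Z_2]_#|Q|]%G, f, (2 ^+ #|Q|)^-1; split.
- split; first by rewrite invr_gt0 exprn_gt0 ?ltr0n.
  by rewrite -prod_op1; apply: eq_prod_op => q; rewrite mxE.
- move=> z w _ _; rewrite /f prod_opM; apply: eq_prod_op => q.
  by rewrite -ZM mxE.
- move=> z _; exists 0.
  exists (fun q => if z 0 (enum_rank q) == 0 then ord0 else inord 3).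
  by rewrite scale1r.
apply: entryP => x y; rewrite entryZ.
have -> : entry (\sum_(z in [set: 'rV['Z_2]_#|Q|]%G) f z) x y =
    \prod_q \sum_z (Z z (x q) (y q)).
  (* Distributivity turns the product over qubits of two-term sums into a sum over all strings. *)
  rewrite bigA_distr_bigA /entry summxE.
  rewrite (reindex (fun h : {ffun Q -> 'Z_2} => \row_i h (enum_val i))) /=.
    apply: eq_big => h; first by rewrite inE.
    move=> _; rewrite mxE !enum_rankK; apply: eq_bigr => q _.
    by rewrite mxE enum_rankK.
  exists (fun z : 'rV['Z_2]_#|Q| => [ffun q => z 0 (enum_rank q)]) => h _.
    by apply/ffunP => q; rewrite ffunE mxE enum_rankK.
  by apply/rowP => i; rewrite mxE ffunE enum_valK.
(* One-qubit identity [1 + Z = 2 |0><0|]; the factors 2 cancel the normalization. *)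
have ZS a b : \sum_z Z z a b = 2 * ((a == 0) && (b == 0))%:R.
  rewrite !big_ord_recl big_ord0 addr0 /Z /= /sigma inordK //= !mxE.
  case: a => [[|[|//]]] ha; case: b => [[|[|//]]] hb;
  by rewrite /= ?expr0 ?expr1 ?mulr1 ?mul1r ?mul0r ?addr0 ?subrr ?mulr0.
under eq_bigr => q _ do rewrite ZS.
rewrite big_split /= prodr_const prodr_forall mulrA mulVf ?mul1r; last first.
  by rewrite expf_neq0 // pnatr_eq0.
rewrite /entry !mxE big_ord1 !mxE !(inj_eq enum_rank_inj) !andbT rmorph_nat.
rewrite -natrM mulnb -!eq_cfgE; congr (_%:R); congr nat_of_bool.
apply/andP/forallP => [[/forallP hx /forallP hy] q|h].
  by have := hx q; have := hy q; rewrite !ffunE => -> ->.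
by split; apply/forallP => q; rewrite ffunE; case/andP: (h q).
Qed.

End StabilizerOperators.

(** * Purity of a state dominated by a stabilizer state *)

Section Purity.
Variables (C : numClosedFieldType) (Q : finType).

Lemma Pur_flat (A : op C Q) (p : C) :
  \tr A = 1 -> A *m A = p *: A -> Pur A = p.
Proof. by move=> trA AA; rewrite /Pur AA mxtraceZ trA mulr1. Qed.

Lemma Pur_le_stabilizer (A B : op C Q) (c : C) :
  0 <= c -> psd A -> psd B -> psd (c *: B - A) -> stabilizer_op B ->
  \tr A = 1 -> \tr B = 1 -> Pur A <= c * Pur B.
Proof.
move=> c0 psdA psdB leAB /stabilizer_op_flat[p p0 BB] trA trB.
rewrite (Pur_flat trB BB).
apply: (le_trans (y := c * \tr (A *m B))).
  have := psd_traceM_ge0 psdA leAB.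
  by rewrite mulmxBr -scalemxAr linearB /= mxtraceZ subr_ge0.
apply: ler_wpM2l => //.
by have := flat_traceM_le psdB psdA p0 BB; rewrite trA mulr1.
Qed.

End Purity.

(** * The depolarized state and its domination of the pure state *)

Section PureStates.
Variables (C : numClosedFieldType) (Q : finType).

Lemma proj_mulmx (U : op C Q) (v : ket C Q) :
  proj (U *m v) = U *m proj v *m U ^t*.
Proof. by rewrite /proj trmxCM !mulmxA. Qed.

Lemma mxtrace_proj_ket0 : \tr (proj (ket0 : ket C Q)) = 1.
Proof.
rewrite /mxtrace (bigD1 (enum_rank [ffun=> ord0])) //= big1 => [|i /negbTE hi].
  by rewrite addr0 mxE big_ord1 !mxE !eqxx conjC1 mulr1.
by rewrite mxE big_ord1 !mxE hi mul0r.
Qed.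

Lemma mxtrace_unitary_conj (U A : op C Q) :
  U \is unitarymx -> \tr (U *m A *m U ^t*) = \tr A.
Proof. by move=> Uu; rewrite mxtrace_mulC mulmxA unitarymx_trmxCK ?mul1mx. Qed.

Definition depolarize (Y : {set Q}) (W A : op C Q) : op C Q :=
  W ^t* *m tensor_op (((2 ^+ #|Y|)^-1)%:M : op C (sub_label Y))
                     (ptrace Y (W *m A *m W ^t*)) *m W.

(* [W^* U K |0>] is a stabilizer state acted upon, in the frame [W], by a
   unitary [U] on [Y], which the trace over [Y] does not see. *)
Lemma Pur_ptrace_le_depolarize (X Y : {set Q}) (W U K psi : op C Q) :
  clifford W -> clifford K -> U \is unitarymx -> acts_only_on Y U ->
  psi = proj (W ^t* *m U *m K *m ket0) ->
  Pur (ptrace X psi) <=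
  (2 ^+ #|Y|) ^+ 2 * Pur (ptrace X (depolarize Y W psi)).
Proof.
move=> WC KC Uu locU psiE; set d : C := 2 ^+ #|Y|; set rho := depolarize _ _ _.
have [[Wu _] [Ku _]] := conj WC KC.
have d0 : 0 < d by rewrite exprn_gt0 ?ltr0n.
have dE : d = (2 ^ #|Y|)%:R by rewrite natrX.
have psd_psi : psd psi by rewrite psiE; exists 1, (W ^t* *m U *m K *m ket0).
have WpsiW : W *m psi *m W ^t* = U *m proj (K *m ket0) *m U ^t*.
  by rewrite psiE -!proj_mulmx !mulmxA (unitarymxP Wu) mul1mx.
have stab_rho : stabilizer_op rho.
  have := clifford_trmxC WC => /stabilizer_op_conj; rewrite trmxCK; apply.
  apply: stabilizer_op_tensor; first by rewrite invr_gt0.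
  rewrite WpsiW ptrace_local_unitary // proj_mulmx.
  exact/stabilizer_op_ptrace/stabilizer_op_conj/stabilizer_op_ket0.
(* One factor [d] comes from the domination by [1 (x) tr_Y], the other compensates the [d^-1] inside
   [rho]. *)
have dom : psd (d ^+ 2 *: rho - psi).
  have := psd_conj (W ^t*) (psd_tensor_ptrace_sub Y (psd_conj W psd_psi)).
  rewrite trmxCK mulmxBr mulmxBl -dE.
  have -> : W ^t* *m (W *m psi *m W ^t*) *m W = psi.
    by rewrite !mulmxA unitarymx_trmxCK // mul1mx -mulmxA unitarymx_trmxCK
       ?mulmx1.
  rewrite /rho /depolarize -/d (tensor_scalarE d^-1) -!scalemxAr.
  rewrite -!scalemxAl scalerA expr2 mulfK //.
  by rewrite gt_eqF.
have d20 : 0 < d ^+ 2 by rewrite exprn_gt0.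
(* Positivity of [rho] follows from the domination by adding back the positive [psi]. *)
have psd_rho : psd rho.
  have -> : rho = (d ^+ 2)^-1 *: (d ^+ 2 *: rho - psi + psi).
    by rewrite subrK scalerA mulVf ?gt_eqF // scale1r.
  by apply: psdZ; [rewrite invr_ge0 ltW | apply: psdD].
have tr_psi : \tr psi = 1.
  rewrite psiE proj_mulmx mxtrace_unitary_conj ?mxtrace_proj_ket0 //.
  apply: mul_unitarymx => //; apply: mul_unitarymx => //.
  by rewrite trmxC_unitary.
have tr_rho : \tr rho = 1.
  rewrite /rho /depolarize -/d mxtrace_mulC mulmxA (unitarymxP Wu) mul1mx.
  rewrite -(mxtrace_ptrace Y) tensor_scalarE ptraceZ ptrace_tensor_op1 -dE.
  by rewrite scalerA mulVf ?gt_eqF // scale1r mxtrace_ptrace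
     mxtrace_unitary_conj.
apply: Pur_le_stabilizer; rewrite ?mxtrace_ptrace ?ltW //.
- exact: psd_ptrace.
- exact: psd_ptrace.
- by rewrite -ptraceZ -ptraceB; apply: psd_ptrace.
- exact: stabilizer_op_ptrace.
Qed.

(** Inserting [T^* T = 1] on both sides of [c] moves its support to [Y] when [T] is the qubit
    permutation, and exhibits [W = T D] as the frame. *)
Lemma conj_change_frame (T D c V : op C Q) : T \is unitarymx ->
  D ^t* *m c *m D *m V =
  (T *m D) ^t* *m (T *m c *m T ^t*) *m (T *m D *m V).
Proof.
move=> Tu; rewrite trmxCM !mulmxA -!(mulmxA _ (T ^t*) T).
by rewrite unitarymx_trmxCK ?mulmx1.
Qed.

End PureStates.

(** * The purity bound for both parts of the bipartition *)

Local Open Scope complex_scope.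

Theorem proposition4 (R : realType) (n t : nat) (E F S Y : {set 'I_n})
    (Ct ct D V : op R[i] 'I_n) (piY : {perm 'I_n}) :
  E :|: F = setT -> [disjoint E & F] ->
  (t <= n)%N -> (t <= #|F|)%N ->
  doped_clifford t Ct ->
  clifford D -> clifford V ->
  doped_clifford t ct -> #|S| = t -> acts_only_on S ct ->
  Ct = D ^t* *m ct *m D *m V ->
  Y \subset F -> #|Y| = t ->
  let TY := perm_op R[i] piY in
  acts_only_on Y (TY *m ct *m TY ^t*) ->
  let W := TY *m D in
  let psi_t := proj (Ct *m ket0) in
  let d_Y := 2 ^+ #|Y| : R[i] in
  let rho := W ^t* *m tensor_op ((d_Y^-1)%:M : op R[i] (sub_label Y))
                                (ptrace Y (W *m psi_t *m W ^t*)) *m W in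
  let psi_E := ptrace F psi_t in
  let rho_E := ptrace F rho in
  let rho_F := ptrace E rho in
  Pur psi_E <= d_Y ^+ 2 * Pur rho_E /\ Pur psi_E <= d_Y ^+ 2 * Pur rho_F.
Proof.
move=> EF disEF _ _ _ DC VC ctC _ _ -> _ _ TY locY W.
have [TYu _] : clifford TY by exact: clifford_perm_op.
have WC : clifford W by apply: clifford_mul DC; exact: clifford_perm_op.
have Uu : TY *m ct *m TY ^t* \is unitarymx.
  apply: mul_unitarymx; last by rewrite trmxC_unitary.
  by apply: mul_unitarymx; last exact: doped_clifford_unitary ctC.
have WVC : clifford (W *m V) by exact: clifford_mul.
rewrite (conj_change_frame D ct V TYu) -/W => psi d rho psi_E rho_E rho_F.
have main X := Pur_ptrace_le_depolarize X WC WVC Uu locY (erefl psi).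
split; first exact: main.
(* For [rho_F] the general bound controls the purity of [psi] reduced to [F]; this equals the purity
   of [psi_E], because [E] and [F] are complementary and [psi] is pure. *)
have EE : E = ~: F.
  apply/eqP; rewrite eqEsubset -disjoints_subset disEF.
  by apply/subsetP => q; have := in_setT q; rewrite -EF !inE => /orP[//|->].
by rewrite /psi_E -Pur_ptrace_setC /rho_F EE; exact: main.
Qed.
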